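(* Let $(P,\leq,{}',0,1)$ be a bounded poset (least element $0$, greatest element $1$) with a unary operation ${}'$ such that $1'=0$ and, for all $x,y\in P$, $L(x)\subseteq L(U(L(U(x,y'),y),y'))$ and $L(U(L(x,y),y'),y)\subseteq L(x)$. Define $M,R:P^2\to 2^P$ by $M(x,y)=L(U(x,y'),y)$ and $R(x,y)=L(U(L(y,x),x'))$. Then $(P,\leq,{}',M,R,0,1)$ is an operator left residuated poset.
   Context: For a poset $(P,\leq)$ and $A\subseteq P$ let $L(A)=\{x\in P\mid x\leq a\text{ for all }a\in A\}$ and $U(A)=\{x\in P\mid a\leq x\text{ for all }a\in A\}$; write $L(x)=L(\{x\})$, and when several elements or subsets are listed as arguments the union of them is meant, e.g. $L(x,y)=L(\{x,y\})$, $L(U(x,y'),y)=L(U(\{x,y'\})\cup\{y\})$. An operator left residuated poset is an ordered seventuple $(P,\leq,{}',M,R,0,1)$ where $(P,\leq,0,1)$ is a bounded poset, ${}'$ a unary operation on $P$, and $M,R:P^2\to 2^P$ satisfy for all $x,y,z\in P$: (i) $M(x,1)=M(1,x)=L(x)$; (ii) $M(x,y)\subseteq L(z)$ if and only if $L(x)\subseteq R(y,z)$; (iii) $R(x,0)=L(x')$. *)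

(* Defs.v *)
From mathcomp Require Import all_boot all_order.
From mathcomp Require Import boolp classical_sets.

Set Implicit Arguments.
Unset Strict Implicit.
Unset Printing Implicit Defensive.

Local Open Scope order_scope.
Local Open Scope classical_set_scope.

(* The cones L(A) and U(A) are [lbound A] and [ubound A];
   several arguments denote a union, so L(U(x, y'), y) is
   [lbound (ubound [set x; y'] `|` [set y])]. *)

(* The poset with its bounds 0 = \bot and 1 = \top is bundled in [P]. *)
Record operator_left_residuated (d : Order.disp_t) (P : tbPOrderType d)
    (neg : P -> P) (M R : P -> P -> set P) : Prop := OperatorLeftResiduated {
  olr_mulr1 : forall x : P, M x \top = lbound [set x];
  olr_mul1r : forall x : P, M \top x = lbound [set x];
  olr_adj : forall x y z : P,
    M x y `<=` lbound [set z] <-> lbound [set x] `<=` R y z;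
  olr_res0 : forall x : P, R x \bot = lbound [set neg x]
}.

Definition sasaki_mul (d : Order.disp_t) (P : tbPOrderType d) (neg : P -> P)
    (x y : P) : set P :=
  lbound (ubound [set x; neg y] `|` [set y]).

Definition sasaki_res (d : Order.disp_t) (P : tbPOrderType d) (neg : P -> P)
    (x y : P) : set P :=
  lbound (ubound (lbound [set y; x] `|` [set neg x])).

(* Main.v *)
Require Import Defs.
From mathcomp Require Import all_boot all_order.
From mathcomp Require Import boolp classical_sets.

Import Order.TTheory.

Local Open Scope order_scope.
Local Open Scope classical_set_scope.

(** Cones reverse inclusion, so $LU$ is monotone. The two inequalities act as unit and counit of the
    adjunction: applying $R(y,-)$ to $M(x,y)$ recovers at least $L(x)$, and multiplying $R(y,z)$ by
    $y$ stays inside $L(z)$. Monotonicity of the cones turns them into the equivalence; the unit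
    laws and $R(x,0)=L(x')$ are direct cone computations with the bounds. *)

Lemma sub_lbound (d : Order.disp_t) (P : porderType d) (A B : set P) :
  A `<=` B -> lbound B `<=` lbound A.
Proof. by move=> AB x Bx y /AB /Bx. Qed.

Lemma sub_ubound (d : Order.disp_t) (P : porderType d) (A B : set P) :
  A `<=` B -> ubound B `<=` ubound A.
Proof. by move=> AB x Bx y /AB /Bx. Qed.

Theorem theorem1 (d : Order.disp_t) (P : tbPOrderType d) (neg : P -> P)
  (neg1 : neg \top = \bot)
  (le_res_mul : forall x y : P,
    lbound [set x] `<=`
    lbound (ubound (lbound (ubound [set x; neg y] `|` [set y])
                    `|` [set neg y])))
  (mul_res_le : forall x y : P,
    lbound (ubound (lbound [set x; y] `|` [set neg y]) `|` [set y]) `<=`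
    lbound [set x]) :
  operator_left_residuated neg (sasaki_mul neg) (sasaki_res neg).
Proof.
split=> [x|x|x y z|x].
- apply/seteqP; split=> t tx.
    move=> _ ->; apply: tx; left; rewrite neg1 => _ [] ->; first exact: lexx.
    exact: le0x.
  have {}tx : t <= x by exact: tx.
  move=> u [ux|->]; last exact: lex1.
  by apply: (le_trans tx); apply: ux; left.
- apply/seteqP; split=> t tx.
    by move=> _ ->; apply: tx; right.
  move=> u [u1|->]; last exact: tx.
  by apply: (le_trans (lex1 t)); apply: u1; left.
- split=> [Mz | xR].
    apply: (subset_trans (le_res_mul x y)).
    (* $M(x,y)$ always lies below $y$, so it lies in $L(z,y)$, the cone inside $R(y,z)$. *)
    apply/sub_lbound/sub_ubound/setSU => t Mt w [] ->; first exact: Mz.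
    by apply: Mt; right.
  apply: subset_trans (mul_res_le z y).
  (* Since $x\in R(y,z)$, every element of $U(L(z,y),y')$ is above $x$, hence in $U(x,y')$. *)
  apply/sub_lbound/setSU => u u_ub w [] ->.
    by apply: (xR x) => // v ->.
  by apply: u_ub; right.
- apply/seteqP; split=> t tx.
    (* Every element of $L(0,x)$ is below $0$, so $x'$ bounds $L(0,x)\cup\{x'\}$. *)
    move=> _ ->; apply: tx => w [w0|->]; last exact: lexx.
    by apply: (le_trans (w0 \bot _)); [left | exact: le0x].
  move=> u ux; apply: (le_trans (tx _ erefl)).
  by apply: ux; right.
Qed.
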